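(* Suppose that $w(t)=0$ for all $t\in[0,1]$. Then the second-order problem (B) described in the context can be replaced by $$\dot v^2(t)=\beta^2\,v^2(t)+2\,\gamma\,e^{v(t)}+C_i\,,\quad\text{for all } t\in[t_i,t_{i+1}),\ i=0,1,\ldots,n,$$ with $\dot v(1)=0$, where $\gamma$ is some real number, and $$C_i=C_{i-1}-\frac{2}{\alpha}\,\dot v(t_i^-)+\frac{1}{\alpha^2}\,,\quad\text{for } i=1,\ldots,n,$$ with $$C_0=-\beta^2\,v^2(0)-2\,\gamma\,e^{v(0)}\,.$$
   Context: Let $0=t_0<t_1<\cdots<t_n<t_{n+1}=1$, where $t_1,\ldots,t_n$ are given sample points, let $\alpha>0$ and $\beta$ be real constants, and let $w:[0,1]\to\mathbb{R}$ be a given continuous function. Consider the two-point boundary-value problem with interior jump conditions, for functions $z,v:[0,1]\to\mathbb{R}$ and a real constant $\gamma$, consisting of the following two parts, with the differential equations holding for all $t\in(t_i,t_{i+1})$, $i=0,\ldots,n$: (A) $\dot z(t)=e^{v(t)}$, $z(0)=0$, $z(1)=1$; (B) $\ddot v(t)=\beta^2\,(v(t)-w(t))+\gamma\,e^{v(t)}$, $\dot v(0)=0$, $\dot v(1)=0$, and $\dot v(t_j^+)=\dot v(t_j^-)-\frac{1}{\alpha}$ for $j=1,\ldots,n$. Dots denote derivatives with respect to $t$, and $\dot v(t_j^-)$, $\dot v(t_j^+)$ denote the left and right limits of $\dot v$ at $t_j$. The function $v$ is continuous on $[0,1]$; only $\dot v$ jumps at the points $t_j$. At the left endpoint $t=t_i$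 ($i\ge1$) of $[t_i,t_{i+1})$, $\dot v(t_i)$ is read as $\dot v(t_i^+)$.
   Formalization: The replacement is not an equivalence as stated: the first-order problem implies (B) only if also v'(t_j^+) is not opposite in sign to v'(t_j^-)-1/α, and v'=0 on an interval only where β²v+γe^v=0; (B) implies both conditions. *)

(* Defs.v *)
From Stdlib Require Import Reals.
From Coquelicot Require Import Coquelicot.

Open Scope R_scope.

(* Functions on [0,1] are total functions on R of which only the values on
   [0,1] are ever used. *)
Definition on_unit (x : R) : Prop := 0 <= x <= 1.

Definition sample_grid (n : nat) (t : nat -> R) : Prop :=
  t 0%nat = 0 /\ t (S n) = 1 /\
  (forall i : nat, (i <= n)%nat -> t i < t (S i)).

Definition diff_quotient (v : R -> R) (a s : R) : R := (v s - v a) / (s - a).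

(* [dv] is the derivative of [v] on [0,1]: two-sided inside the subintervals,
   one-sided at 0 and at 1.  At an interior node, where the derivative may
   jump, [dv] takes the value of its right limit. *)
Record is_dot (n : nat) (t : nat -> R) (v dv : R -> R) : Prop := {
  dot_inside : forall (i : nat) (s : R), (i <= n)%nat -> t i < s < t (S i) ->
    is_derive v s (dv s);
  dot_zero : filterlim (diff_quotient v 0) (at_right 0) (locally (dv 0));
  dot_one : filterlim (diff_quotient v 1) (at_left 1) (locally (dv 1));
  dot_node : forall j : nat, (1 <= j <= n)%nat ->
    filterlim dv (at_right (t j)) (locally (dv (t j)))
}.

Definition is_left_limit (f : R -> R) (a m : R) : Prop :=
  filterlim f (at_left a) (locally m).

Record second_order_problem (n : nat) (t : nat -> R) (alpha beta : R)
    (w : R -> R) (gamma : R) (v dv : R -> R) : Prop := {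
  so_ode : forall (i : nat) (s : R), (i <= n)%nat -> t i < s < t (S i) ->
    is_derive dv s (beta ^ 2 * (v s - w s) + gamma * exp (v s));
  so_zero : dv 0 = 0;
  so_one : dv 1 = 0;
  so_jump : forall j : nat, (1 <= j <= n)%nat ->
    exists m : R, is_left_limit dv (t j) m /\ dv (t j) = m - 1 / alpha
}.

Record first_order_system (n : nat) (t : nat -> R) (alpha beta gamma : R)
    (v dv : R -> R) (C : nat -> R) : Prop := {
  fo_ode : forall (i : nat) (s : R), (i <= n)%nat -> t i <= s < t (S i) ->
    dv s ^ 2 = beta ^ 2 * v s ^ 2 + 2 * gamma * exp (v s) + C i;
  fo_one : dv 1 = 0;
  fo_step : forall i : nat, (1 <= i <= n)%nat ->
    exists m : R, is_left_limit dv (t i) m /\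
      C i = C (i - 1)%nat - 2 / alpha * m + 1 / alpha ^ 2;
  fo_init : C 0%nat = - beta ^ 2 * v 0 ^ 2 - 2 * gamma * exp (v 0)
}.

Definition first_order_problem (n : nat) (t : nat -> R) (alpha beta gamma : R)
    (v dv : R -> R) : Prop :=
  exists C : nat -> R, first_order_system n t alpha beta gamma v dv C.

(* The first-order problem only sees the square of the derivative, hence has
   spurious solutions of two kinds.

   The recursion for [C] determines the right derivative at a node only up to
   sign; [jump_branch] selects the sign (for beta = 0 and gamma < 0 the second-
   order problem with n >= 1 has no solution, whereas the other sign allows
   the derivative to come back to 0 at time 1). *)
Definition jump_branch (n : nat) (t : nat -> R) (alpha : R) (dv : R -> R)
    : Prop :=
  forall (j : nat) (m : R), (1 <= j <= n)%nat -> is_left_limit dv (t j) m ->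
    0 <= dv (t j) * (m - 1 / alpha).

(* With n = 0 every constant [v] solves the first-order problem for every
   [gamma], and in general a solution may rest at a turning point for an
   arbitrary time; [rests_at_equilibria] only allows rest where the right-hand
   side of the second-order equation (with w = 0) vanishes. *)
Definition rests_at_equilibria (n : nat) (t : nat -> R) (beta gamma : R)
    (v dv : R -> R) : Prop :=
  forall (i : nat) (a b : R), (i <= n)%nat ->
    t i <= a -> a < b -> b <= t (S i) ->
    (forall s : R, a < s < b -> dv s = 0) ->
    forall s : R, a < s < b -> beta ^ 2 * v s + gamma * exp (v s) = 0.

(* Main.v *)
(* With [w = 0] the energy [dv^2 - beta^2 v^2 - 2 gamma e^v] is constant on each
   subinterval, which gives the first-order equation; squaring the jump condition
   gives the recursion for the constants.

   Conversely let [v'^2 = F(v)] with [F' = 2 G].  Where [v' <> 0], Darboux's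
   theorem fixes the sign, so [v' = ± sqrt (F v)] locally, and differentiating
   yields [v'' = G(v)].  Where [v' = 0] and [G(v) <> 0], the absence of rest makes
   the zero of [v'] isolated, so [v'' = G(v)] extends to it by continuity.  Where
   [v' = 0] and [G(v) = 0], [F] has a double zero, and [v'' = 0]. *)
Require Import Defs.
From Stdlib Require Import Reals Lra Lia.
From Coquelicot Require Import Coquelicot.

Open Scope R_scope.

(** * Neighbourhoods, Darboux's theorem and mean value arguments *)

Lemma locally_ball_intro (a d : R) (P : R -> Prop) :
  0 < d -> (forall x, Rabs (x - a) < d -> P x) -> locally a P.
Proof. intros hd h. exists (mkposreal d hd). exact h. Qed.

Lemma locally_interval (a b x : R) : a < x < b -> locally x (fun y => a < y < b).
Proof.
  intros hx. apply (locally_ball_intro x (Rmin (x - a) (b - x))).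
  - apply Rmin_pos; lra.
  - intros y hy. apply Rabs_def2 in hy.
    pose proof (Rmin_l (x - a) (b - x)). pose proof (Rmin_r (x - a) (b - x)). lra.
Qed.

Lemma at_right_interval (a b : R) : a < b -> at_right a (fun x => a < x < b).
Proof.
  intros hab. apply (locally_ball_intro a (b - a)); [lra|].
  intros y hy h. apply Rabs_def2 in hy. lra.
Qed.

Lemma at_left_interval (a b : R) : a < b -> at_left b (fun x => a < x < b).
Proof.
  intros hab. apply (locally_ball_intro b (b - a)); [lra|].
  intros y hy h. apply Rabs_def2 in hy. lra.
Qed.

Lemma derive_zero_at_max (f : R -> R) (a b c l : R) :
  a < c < b -> (forall x, a < x < b -> f x <= f c) -> is_derive f c l -> l = 0.
Proof.
  intros hc hmax hd. apply is_derive_Reals in hd.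
  exact (deriv_maximum f a b c (exist _ l hd) (proj1 hc) (proj2 hc)
           (fun x h1 h2 => hmax x (conj h1 h2))).
Qed.

(** A difference quotient within |l| of l has the sign of l. The product form treats both sides of
    [a] at once. It serves to exclude extrema at end points and to isolate simple zeros of [F]. *)
Lemma derive_sign (f : R -> R) (a l : R) :
  is_derive f a l -> l <> 0 ->
  exists d, 0 < d /\
    forall x, x <> a -> Rabs (x - a) < d -> 0 < l * ((x - a) * (f x - f a)).
Proof.
  intros hd hl. apply is_derive_Reals in hd.
  destruct (hd (Rabs l) (Rabs_pos_lt l hl)) as [d h].
  exists d. split; [apply cond_pos|]. intros x hx hxd.
  assert (hne : x - a <> 0) by lra.
  specialize (h (x - a) hne hxd). replace (a + (x - a)) with x in h by ring.
  set (q := (f x - f a) / (x - a)) in *.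
  replace (f x - f a) with (q * (x - a)) by (unfold q; field; lra).
  assert (hlq : 0 < l * q).
  { unfold Rabs in h. destruct (Rcase_abs (q - l)), (Rcase_abs l); nra. }
  replace (l * ((x - a) * (q * (x - a)))) with (l * q * (x - a)²)
    by (unfold Rsqr; ring).
  apply Rmult_lt_0_compat; [exact hlq|]. now apply Rlt_0_sqr.
Qed.

Lemma is_derive_continuity_pt (f : R -> R) (x l : R) :
  is_derive f x l -> continuity_pt f x.
Proof.
  intros h. apply continuity_pt_filterlim.
  apply (ex_derive_continuous (V := R_NormedModule) f x). now exists l.
Qed.

(** The derivative need not be continuous, so the zero is found as a critical point: if [df] is
    positive at [a] and negative at [b], neither end can carry the maximum of [f]. The opposite
    signs reduce to [- f]. *)
Lemma darboux_zero (f df : R -> R) (a b : R) :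
  a < b -> (forall x, a <= x <= b -> is_derive f x (df x)) ->
  df a * df b < 0 -> exists c, a < c < b /\ df c = 0.
Proof.
  intros hab.
  assert (main : forall g dg : R -> R,
    (forall x, a <= x <= b -> is_derive g x (dg x)) ->
    0 < dg a -> dg b < 0 -> exists c, a < c < b /\ dg c = 0).
  { intros g dg hg ha hb.
    destruct (continuity_ab_maj g a b) as [c [hmax hc]]; [lra| |].
    { intros x hx. eapply is_derive_continuity_pt. now apply hg. }
    assert (hca : c <> a).
    { intros ->. destruct (derive_sign g a (dg a)) as [d [hd h]].
      - apply hg; lra.
      - lra.
      - assert (hm := Rmin_pos d (b - a) hd ltac:(lra)).
        pose proof (Rmin_l d (b - a)). pose proof (Rmin_r d (b - a)).
        set (e := Rmin d (b - a)) in *.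
        specialize (h (a + e / 2) ltac:(lra)
          ltac:(rewrite Rabs_pos_eq; lra)).
        specialize (hmax (a + e / 2) ltac:(lra)).
        assert (0 < dg a * (a + e / 2 - a)) by (apply Rmult_lt_0_compat; lra).
        nra. }
    assert (hcb : c <> b).
    { intros ->. destruct (derive_sign g b (dg b)) as [d [hd h]].
      - apply hg; lra.
      - lra.
      - assert (hm := Rmin_pos d (b - a) hd ltac:(lra)).
        pose proof (Rmin_l d (b - a)). pose proof (Rmin_r d (b - a)).
        set (e := Rmin d (b - a)) in *.
        specialize (h (b - e / 2) ltac:(lra)
          ltac:(rewrite Rabs_left; lra)).
        specialize (hmax (b - e / 2) ltac:(lra)).
        assert (0 < - dg b * (b - (b - e / 2))) by (apply Rmult_lt_0_compat; lra).
        nra. }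
    exists c. split; [lra|].
    apply (derive_zero_at_max g a b c); [lra| |apply hg; lra].
    intros x hx. apply hmax. lra. }
  intros hf hneg. destruct (Rlt_or_le 0 (df a)) as [ha|ha].
  - apply (main f df hf ha). nra.
  - assert (ha0 : df a <> 0) by (intros h0; rewrite h0 in hneg; lra).
    destruct (main (fun x => - f x) (fun x => - df x)) as [c [hc h]].
    + intros x hx. apply (is_derive_opp f x (df x)). now apply hf.
    + lra.
    + nra.
    + exists c. split; [exact hc|lra].
Qed.

(** By the mean value theorem the difference quotient at [a] is [g c] with [c] between [a] and
    [a + h], and [g] is continuous at [a]. This handles turning points, where the derivative is
    first known only on a punctured neighbourhood. *)
Lemma is_derive_extend (f g : R -> R) (a : R) :
  locally' a (fun x => is_derive f x (g x)) ->
  continuous f a -> continuous g a -> is_derive f a (g a).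
Proof.
  intros [d hd] hf hg. apply is_derive_Reals. intros eps heps.
  destruct (proj1 (filterlim_locally _ _) hg (mkposreal eps heps)) as [d' hd'].
  assert (hm := Rmin_pos d d' (cond_pos d) (cond_pos d')).
  exists (mkposreal _ hm). intros h hh hlt. simpl in hlt.
  pose proof (Rmin_l d d'). pose proof (Rmin_r d d').
  destruct (MVT_gen f a (a + h) g) as [c [hc hfc]].
  - intros x hx.
    assert (hxa : x <> a /\ Rabs (x - a) < d).
    { unfold Rmin, Rmax in hx. destruct (Rle_dec a (a + h)); split; try lra.
      - rewrite Rabs_pos_eq by lra. rewrite Rabs_pos_eq in hlt by lra. lra.
      - rewrite Rabs_left by lra. rewrite Rabs_left in hlt by lra. lra. }
    apply hd; [exact (proj2 hxa)|exact (proj1 hxa)].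
  - intros x hx. destruct (Req_dec x a) as [->|hxa].
    + now apply continuity_pt_filterlim.
    + apply (is_derive_continuity_pt f x (g x)), hd; [|exact hxa].
      change (Rabs (x - a) < d).
      unfold Rmin, Rmax in hx. destruct (Rle_dec a (a + h)).
      * rewrite Rabs_pos_eq by lra. rewrite Rabs_pos_eq in hlt by lra. lra.
      * unfold Rabs in *. destruct (Rcase_abs (x - a)), (Rcase_abs h); lra.
  - rewrite hfc. replace (g c * (a + h - a) / h) with (g c) by (field; exact hh).
    apply hd'. change (Rabs (c - a) < d').
    unfold Rmin, Rmax in hc. unfold Rabs in *.
    destruct (Rle_dec a (a + h)), (Rcase_abs (c - a)), (Rcase_abs h); lra.
Qed.

Lemma mvt_right (f df : R -> R) (a b : R) :
  a < b -> (forall x, a < x <= b -> is_derive f x (df x)) ->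
  filterlim f (at_right a) (locally (f a)) ->
  exists c, a < c < b /\ f b - f a = df c * (b - a).
Proof.
  intros hab hd hf.
  (* Freezing [f] at the value [f a] to the left of [a] turns right continuity into the two-sided
     continuity that [MVT] asks for. *)
  set (g := fun x => f (Rmax a x)).
  assert (hg : forall x, a < x <= b -> is_derive g x (df x)).
  { intros x hx. apply (is_derive_ext_loc f).
    - apply (filter_imp (fun y => a < y < x + 1)).
      + intros y hy. unfold g. now rewrite Rmax_right by lra.
      + apply locally_interval. lra.
    - now apply hd. }
  assert (hg' : forall c, a < c < b -> derivable_pt_lim g c (df c)).
  { intros c hc. apply is_derive_Reals, hg. lra. }
  destruct (MVT g id a b (fun c hc => exist _ (df c) (hg' c hc))
    (fun c _ => derivable_pt_id c) hab) as [c [hc h]].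
  - intros c hc. destruct (Req_dec c a) as [->|hca].
    + apply continuity_pt_filterlim, filterlim_locally. intros eps.
      destruct (proj1 (filterlim_locally _ _) hf eps) as [d h].
      exists d. intros y hy. unfold g. rewrite (Rmax_left a a) by lra.
      destruct (Rle_or_lt y a) as [hya|hya].
      * rewrite Rmax_left by exact hya. apply ball_center.
      * rewrite Rmax_right by lra. now apply h.
    + apply (is_derive_continuity_pt g c (df c)), hg. lra.
  - intros c hc. apply derivable_continuous_pt, derivable_pt_id.
  - exists c. split; [exact hc|].
    rewrite derive_pt_id in h. unfold id, g in h. simpl in h.
    rewrite (Rmax_left a a), (Rmax_right a b) in h by lra. lra.
Qed.

Lemma filterlim_sqr (Fl : (R -> Prop) -> Prop) {HF : Filter Fl} (f : R -> R) (m : R) :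
  filterlim f Fl (locally m) -> filterlim (fun r => f r ^ 2) Fl (locally (m ^ 2)).
Proof.
  intros hf. apply (filterlim_comp _ _ _ f (fun y => y ^ 2) _ (locally m)); [exact hf|].
  apply (ex_derive_continuous (V := R_NormedModule) (fun y : R => y ^ 2)).
  auto_derive; exact I.
Qed.

(** Each quotient at [x] equals [df c] for some [c] between [a] and [x], so its square follows
    [df ^ 2] to [L]. Only squares are known to converge, hence [d] is determined up to sign. *)
Lemma one_sided_derivative_sqr (f df : R -> R) (a b d L : R) :
  a < b -> (forall x, a < x < b -> is_derive f x (df x)) ->
  filterlim f (at_right a) (locally (f a)) ->
  filterlim (diff_quotient f a) (at_right a) (locally d) ->
  filterlim (fun x => df x ^ 2) (at_right a) (locally L) -> d ^ 2 = L.
Proof.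
  intros hab hd hf hq hL.
  assert (hq2 : filterlim (fun x => diff_quotient f a x ^ 2) (at_right a)
                  (locally (d ^ 2))).
  { apply filterlim_sqr; [apply filter_filter|exact hq]. }
  apply (filterlim_locally_unique (K := R_AbsRing) (V := R_NormedModule)
    (F := at_right a) (fun x => diff_quotient f a x ^ 2)); [exact hq2|].
  apply filterlim_locally. intros eps.
  destruct (proj1 (filterlim_locally _ _) hL eps) as [e he].
  apply (filter_imp (fun x => a < x < Rmin b (a + e))).
  - intros x hx. pose proof (Rmin_l b (a + e)). pose proof (Rmin_r b (a + e)).
    destruct (mvt_right f df a x) as [c [hc hfc]]; [lra| |exact hf|].
    { intros y hy. apply hd. lra. }
    unfold diff_quotient. rewrite hfc.
    replace (df c * (x - a) / (x - a)) with (df c) by (field; lra).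
    apply he; [|lra]. change (Rabs (c - a) < e). rewrite Rabs_pos_eq; lra.
  - apply at_right_interval. apply Rmin_glb_lt; [exact hab|].
    pose proof (cond_pos e). lra.
Qed.

(** * From the first integral v'^2 = F(v) back to v'' = G(v) *)

Lemma first_integral_derive_regular (F G v dv : R -> R) (a b s : R) :
  (forall x, is_derive F x (2 * G x)) ->
  (forall r, a < r < b -> is_derive v r (dv r)) ->
  (forall r, a < r < b -> dv r ^ 2 = F (v r)) ->
  a < s < b -> dv s <> 0 -> is_derive dv s (G (v s)).
Proof.
  intros hF hv hE hs hne.
  assert (hFv : is_derive (fun r => F (v r)) s (dv s * (2 * G (v s)))).
  { apply (is_derive_comp F v s (2 * G (v s)) (dv s)); [apply hF|now apply hv]. }
  assert (hpos : 0 < F (v s)) by (rewrite <- hE by exact hs; nra).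
  assert (hloc : locally s (fun r => a < r < b /\ 0 < F (v r))).
  { apply filter_and; [now apply locally_interval|].
    apply (ex_derive_continuous (V := R_NormedModule) (fun r => F (v r)) s
             (ex_intro _ _ hFv) (fun y => 0 < y)).
    now apply open_gt. }
  assert (habs : forall r, a < r < b -> sqrt (F (v r)) = Rabs (dv r))
    by (intros r hr; rewrite <- hE, <- Rsqr_pow2 by exact hr; apply sqrt_Rsqr_abs).
  (* [k] is the sign of [dv s], equal to 1 or -1; near [s] the derivative [dv r] will be
     [k * sqrt (F (v r))]. *)
  set (k := dv s / sqrt (F (v s))).
  assert (hsq : sqrt (F (v s)) * sqrt (F (v s)) = dv s ^ 2)
    by (rewrite sqrt_sqrt by lra; now rewrite hE).
  assert (hsq0 : 0 < sqrt (F (v s))) by now apply sqrt_lt_R0.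
  apply (is_derive_ext_loc (fun r => k * sqrt (F (v r)))).
  - destruct hloc as [d hd]. exists d. intros r hr.
    destruct (hd r hr) as [hrab hrpos].
    assert (hbetween : forall x, (s <= x <= r \/ r <= x <= s) ->
              a < x < b /\ 0 < F (v x)).
    { intros x hx. apply hd. change (Rabs (x - s) < d).
      change (Rabs (r - s) < d) in hr. apply Rabs_def2 in hr.
      apply Rabs_def1; lra. }
    (* A sign change would give a zero [c] of [dv] between [s] and [r], where however
       [dv c ^ 2 = F (v c) > 0]. *)
    assert (hsign : ~ dv s * dv r < 0).
    { intros hneg.
      assert (hz : exists c, (s <= c <= r \/ r <= c <= s) /\ dv c = 0).
      { destruct (Rtotal_order s r) as [hsr|[hsr|hsr]].
        - destruct (darboux_zero v dv s r hsr) as [c [hc h0]]; [|exact hneg|].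
          + intros x hx. apply hv, hbetween. lra.
          + exists c. split; [lra|exact h0].
        - subst r. nra.
        - destruct (darboux_zero v dv r s hsr) as [c [hc h0]]; [|lra|].
          + intros x hx. apply hv, hbetween. lra.
          + exists c. split; [lra|exact h0]. }
      destruct hz as [c [hc h0]]. destruct (hbetween c hc) as [hcab hcpos].
      rewrite <- hE, h0 in hcpos by exact hcab. lra. }
    change (k * sqrt (F (v r)) = dv r :> R).
    unfold k. rewrite !habs by assumption.
    destruct (Rlt_or_le 0 (dv s)) as [h|h].
    + assert (0 <= dv r) by nra. rewrite !Rabs_pos_eq by lra. field. lra.
    + assert (dv r <= 0) by nra. rewrite !Rabs_left1 by lra. field. lra.
  - replace (G (v s)) with
      (k * (dv s * (2 * G (v s)) * / (2 * sqrt (F (v s))))).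
    + apply is_derive_scal.
      apply (is_derive_comp sqrt (fun r => F (v r)) s); [|exact hFv].
      now apply is_derive_Reals, derivable_pt_lim_sqrt.
    + unfold k.
      transitivity (G (v s) * (dv s ^ 2 / (sqrt (F (v s)) * sqrt (F (v s))))).
      * field. lra.
      * rewrite hsq. field. lra.
Qed.

(* [F] vanishes to second order at [v s], so [dv r = O (v r - v s)], which is
   [o (r - s)] because [v] has derivative [0] at [s]. *)
Lemma first_integral_derive_equilibrium (F G v dv : R -> R) (a b s : R) :
  (forall x, is_derive F x (2 * G x)) -> (forall x, ex_derive G x) ->
  (forall r, a < r < b -> is_derive v r (dv r)) ->
  (forall r, a < r < b -> dv r ^ 2 = F (v r)) ->
  a < s < b -> dv s = 0 -> G (v s) = 0 -> is_derive dv s (G (v s)).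
Proof.
  intros hF hG hv hE hs hdv hGs.
  assert (hvs := hv s hs). rewrite hdv in hvs.
  assert (hF0 : F (v s) = 0) by (rewrite <- hE by exact hs; rewrite hdv; ring).
  destruct (hG (v s)) as [l hl]. apply is_derive_Reals in hl.
  destruct (hl 1 Rlt_0_1) as [e he].
  (* Since [G (v s) = 0], tolerance 1 in the derivative of [G] bounds |G x| by (|l| + 1) |x - v s|
     near [v s]. *)
  set (K := Rabs l + 1). assert (hK : 0 < K) by (unfold K; pose proof (Rabs_pos l); lra).
  assert (hGK : forall x, Rabs (x - v s) < e -> Rabs (G x) <= K * Rabs (x - v s)).
  { intros x hx. destruct (Req_dec x (v s)) as [->|hne].
    - rewrite hGs, Rabs_R0. apply Rmult_le_pos; [lra|apply Rabs_pos].
    - assert (h0 : x - v s <> 0) by lra. specialize (he (x - v s) h0 hx).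
      replace (v s + (x - v s)) with x in he by ring.
      rewrite hGs, Rminus_0_r in he.
      replace (G x) with (G x / (x - v s) * (x - v s)) by (field; lra).
      rewrite Rabs_mult. apply Rmult_le_compat_r; [apply Rabs_pos|].
      pose proof (Rabs_triang_inv (G x / (x - v s)) l). unfold K. lra. }
  (* The mean value theorem gives F x = 2 G(c) (x - v s) with [c] no farther from [v s] than [x], so
     the linear bound on [G] becomes a quadratic one on [F]. *)
  assert (hFK : forall x, Rabs (x - v s) < e -> F x <= 2 * K * (x - v s) ^ 2).
  { intros x hx.
    destruct (MVT_gen F (v s) x (fun y => 2 * G y)) as [c [hc h]].
    - intros y _. apply hF.
    - intros y _. eapply is_derive_continuity_pt, hF.
    - assert (hcx : Rabs (c - v s) <= Rabs (x - v s)).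
      { unfold Rmin, Rmax in hc. unfold Rabs.
        destruct (Rle_dec (v s) x), (Rcase_abs (c - v s)), (Rcase_abs (x - v s)); lra. }
      assert (hGc : Rabs (G c) <= K * Rabs (x - v s)).
      { eapply Rle_trans; [apply hGK; lra|]. apply Rmult_le_compat_l; lra. }
      rewrite hF0, Rminus_0_r in h. rewrite h.
      eapply Rle_trans; [apply Rle_abs|].
      rewrite !Rabs_mult, (Rabs_pos_eq 2) by lra.
      rewrite <- (pow2_abs (x - v s)). pose proof (Rabs_pos (x - v s)). nra. }
  rewrite hGs. apply is_derive_Reals. intros eps heps.
  (* For the difference quotients [q] of [v] and [p] of [dv] at [s], the quadratic bound gives p^2
     <= 2 K q^2. So |q| < eta yields p^2 <= 2 K eta^2 < (2 (2 K + 1) eta)^2 = eps^2. *)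
  set (eta := eps / (2 * (2 * K + 1))).
  assert (heta : 0 < eta) by (unfold eta; apply Rdiv_lt_0_compat; lra).
  apply is_derive_Reals in hvs.
  destruct (hvs eta heta) as [d1 h1].
  assert (hcont : locally s (fun r => a < r < b /\ Rabs (v r - v s) < e)).
  { apply filter_and; [now apply locally_interval|].
    exact (proj1 (filterlim_locally _ _)
      (ex_derive_continuous (V := R_NormedModule) v s (ex_intro _ _ (hv s hs))) e). }
  destruct hcont as [d2 h2].
  exists (mkposreal _ (Rmin_pos d1 d2 (cond_pos d1) (cond_pos d2))).
  intros h hh hlt. simpl in hlt.
  pose proof (Rmin_l d1 d2). pose proof (Rmin_r d1 d2).
  specialize (h1 h hh ltac:(lra)). rewrite Rminus_0_r in h1.
  destruct (h2 (s + h)) as [hab hve].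
  { change (Rabs (s + h - s) < d2). replace (s + h - s) with h by ring. lra. }
  rewrite hdv, !Rminus_0_r.
  specialize (hFK _ hve). rewrite <- (hE _ hab) in hFK.
  set (q := (v (s + h) - v s) / h) in *.
  replace (v (s + h) - v s) with (q * h) in hFK by (unfold q; field; exact hh).
  set (p := dv (s + h) / h).
  replace (dv (s + h)) with (p * h) in hFK by (unfold p; field; exact hh).
  assert (hh2 : 0 < h ^ 2) by nra.
  assert (hpq : p ^ 2 <= 2 * K * q ^ 2).
  { apply (Rmult_le_reg_r (h ^ 2)); [exact hh2|]. nra. }
  assert (hq2 : q ^ 2 <= eta ^ 2).
  { rewrite <- (pow2_abs q). apply pow_incr. pose proof (Rabs_pos q). lra. }
  assert (he2 : eps = eta * (2 * (2 * K + 1))) by (unfold eta; field; lra).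
  rewrite <- (Rabs_pos_eq eps) by lra. apply Rsqr_lt_abs_0. unfold Rsqr.
  assert (2 * K * q ^ 2 <= 2 * K * eta ^ 2) by (apply Rmult_le_compat_l; lra).
  assert (0 < eta ^ 2) by nra.
  rewrite he2.
  assert (2 * K * eta ^ 2 < (2 * (2 * K + 1)) ^ 2 * eta ^ 2)
    by (apply Rmult_lt_compat_r; nra).
  nra.
Qed.

(** The maximum and the minimum of [v] on [c, d] both equal [v0]: each is attained at an end or at
    an interior critical point, where F(v) = dv^2 = 0. So [v] is constant there. *)
Lemma rests_between_equal_values (F v dv : R -> R) (v0 c d : R) :
  c < d -> (forall r, c <= r <= d -> is_derive v r (dv r)) ->
  (forall r, c <= r <= d -> dv r ^ 2 = F (v r)) ->
  (forall r, c <= r <= d -> F (v r) = 0 -> v r = v0) ->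
  v c = v0 -> v d = v0 -> F v0 = 0 ->
  forall r, c < r < d -> dv r = 0.
Proof.
  intros hcd hv hE hF hc hd hF0.
  assert (hcrit : forall r, c <= r <= d -> (c < r < d -> dv r = 0) -> v r = v0).
  { intros r hr h. destruct (Req_dec r c) as [->|hrc]; [exact hc|].
    destruct (Req_dec r d) as [->|hrd]; [exact hd|].
    apply hF; [exact hr|]. rewrite <- hE by exact hr. rewrite h by lra. ring. }
  assert (hcv : forall r, c <= r <= d -> continuity_pt v r).
  { intros r hr. eapply is_derive_continuity_pt. now apply hv. }
  destruct (continuity_ab_maj v c d ltac:(lra) hcv) as [x [hmax hx]].
  destruct (continuity_ab_min v c d ltac:(lra) hcv) as [y [hmin hy]].
  assert (hvx : v x = v0).
  { apply hcrit; [exact hx|]. intros hx'.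
    apply (derive_zero_at_max v c d x); [exact hx'| |now apply hv].
    intros z hz. apply hmax. lra. }
  assert (hvy : v y = v0).
  { apply hcrit; [exact hy|]. intros hy'.
    enough (- dv y = 0) by lra.
    apply (derive_zero_at_max (fun z => - v z) c d y); [exact hy'| |].
    - intros z hz. specialize (hmin z ltac:(lra)). lra.
    - apply (is_derive_opp v y (dv y)). now apply hv. }
  intros r hr. specialize (hmax r ltac:(lra)). specialize (hmin r ltac:(lra)).
  assert (hvr : v r = v0) by lra.
  assert (h := hE r ltac:(lra)). rewrite hvr, hF0 in h. nra.
Qed.

(* At a turning point [F] has a simple zero, so nearby zeros of [dv] lie on the
   level [v s]; a second one would force [v] to rest in between. *)
Lemma first_integral_derive_turning (F G v dv : R -> R) (a b s : R) :
  (forall x, is_derive F x (2 * G x)) -> (forall x, ex_derive G x) ->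
  (forall r, a < r < b -> is_derive v r (dv r)) ->
  (forall r, a < r < b -> dv r ^ 2 = F (v r)) ->
  (forall c d, a <= c -> c < d -> d <= b -> (forall r, c < r < d -> dv r = 0) ->
     forall r, c < r < d -> G (v r) = 0) ->
  a < s < b -> dv s = 0 -> G (v s) <> 0 -> is_derive dv s (G (v s)).
Proof.
  intros hF hG hv hE hrest hs hdv hGs.
  assert (hF0 : F (v s) = 0) by (rewrite <- hE by exact hs; rewrite hdv; ring).
  assert (hcv : continuous v s).
  { apply (ex_derive_continuous (V := R_NormedModule) v s).
    exists (dv s). now apply hv. }
  destruct (derive_sign F (v s) (2 * G (v s)) (hF _)) as [e [he hsimple]]; [lra|].
  assert (hGv : continuous (fun r => G (v r)) s).
  { apply (continuous_comp v G); [exact hcv|].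
    now apply (ex_derive_continuous (V := R_NormedModule) G). }
  assert (hloc : locally s (fun r => a < r < b /\ Rabs (v r - v s) < e /\ G (v r) <> 0)).
  { apply filter_and; [now apply locally_interval|]. apply filter_and.
    - exact (proj1 (filterlim_locally _ _) hcv (mkposreal e he)).
    - apply (hGv (fun y => y <> 0)). now apply open_neq. }
  apply (is_derive_extend dv (fun r => G (v r))); [| |exact hGv].
  - destruct hloc as [d hd]. exists d. intros r hr hrs.
    destruct (hd r hr) as [hrab [hve hGr]].
    apply (first_integral_derive_regular F G v dv a b r); try assumption.
    (* If [dv r] vanished too, [v] would have the level [v s] at both [s] and [r] and rest in
       between. The rest hypothesis then gives [G (v x) = 0] at the midpoint, against the choice of
       the neighbourhood. *)
    intros hdr.
    assert (hclose : forall x, (s <= x <= r \/ r <= x <= s) ->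
              a < x < b /\ Rabs (v x - v s) < e /\ G (v x) <> 0).
    { intros x hx. apply hd. change (Rabs (x - s) < d).
      change (Rabs (r - s) < d) in hr. apply Rabs_def2 in hr.
      apply Rabs_def1; lra. }
    assert (hlevel : forall x, Rabs (v x - v s) < e -> F (v x) = 0 -> v x = v s).
    { intros x hx hFx. destruct (Req_dec (v x) (v s)) as [h|h]; [exact h|].
      specialize (hsimple (v x) h hx). rewrite hFx, hF0 in hsimple. lra. }
    assert (hvr : v r = v s).
    { apply hlevel; [exact hve|]. rewrite <- hE by exact hrab. rewrite hdr. ring. }
    destruct (Rtotal_order s r) as [hsr|[hsr|hsr]]; [|congruence|].
    + apply (proj2 (proj2 (hclose ((s + r) / 2) ltac:(lra)))).
      apply (hrest s r); try lra.
      apply (rests_between_equal_values F v dv (v s) s r); auto;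
        intros x hx; destruct (hclose x ltac:(lra)) as [h1 [h2 _]]; auto.
    + apply (proj2 (proj2 (hclose ((s + r) / 2) ltac:(lra)))).
      apply (hrest r s); try lra.
      apply (rests_between_equal_values F v dv (v s) r s); auto;
        intros x hx; destruct (hclose x ltac:(lra)) as [h1 [h2 _]]; auto.
  (* Continuity of [dv] at [s]: its square [F (v r)] tends to [F (v s) = 0], and the tolerance
     [eps * eps] for the square becomes [eps] for [dv]. *)
  - apply filterlim_locally. intros eps.
    assert (hFv : continuous (fun r => F (v r)) s).
    { apply (continuous_comp v F); [exact hcv|].
      apply (ex_derive_continuous (V := R_NormedModule) F). now eexists. }
    assert (heps2 : 0 < eps * eps) by (pose proof (cond_pos eps); nra).
    apply (filter_imp (fun r => a < r < b /\ Rabs (F (v r) - F (v s)) < eps * eps)).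
    + intros r [hr h]. change (Rabs (dv r - dv s) < eps).
      rewrite hF0, <- hE, Rminus_0_r, Rabs_pos_eq in h by (assumption || nra).
      rewrite hdv, Rminus_0_r. pose proof (cond_pos eps).
      rewrite <- (Rabs_pos_eq eps) by lra. apply Rsqr_lt_abs_0. unfold Rsqr. nra.
    + apply filter_and; [now apply locally_interval|].
      exact (proj1 (filterlim_locally _ _) hFv (mkposreal _ heps2)).
Qed.

Lemma first_integral_derive (F G v dv : R -> R) (a b s : R) :
  (forall x, is_derive F x (2 * G x)) -> (forall x, ex_derive G x) ->
  (forall r, a < r < b -> is_derive v r (dv r)) ->
  (forall r, a < r < b -> dv r ^ 2 = F (v r)) ->
  (forall c d, a <= c -> c < d -> d <= b -> (forall r, c < r < d -> dv r = 0) ->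
     forall r, c < r < d -> G (v r) = 0) ->
  a < s < b -> is_derive dv s (G (v s)).
Proof.
  intros hF hG hv hE hrest hs.
  destruct (Req_dec (dv s) 0) as [hdv|hdv].
  - destruct (Req_dec (G (v s)) 0) as [hGs|hGs].
    + now apply (first_integral_derive_equilibrium F G v dv a b s).
    + now apply (first_integral_derive_turning F G v dv a b s).
  - now apply (first_integral_derive_regular F G v dv a b s).
Qed.

(** * One-sided limits and conservation of energy on a subinterval *)

Lemma continuous_on_at_right (v : R -> R) (a : R) :
  continuous_on on_unit v -> 0 <= a < 1 ->
  filterlim v (at_right a) (locally (v a)).
Proof.
  intros hv ha P hP. specialize (hv a ltac:(unfold on_unit; lra) P hP).
  assert (h1 := at_right_interval a 1 (proj2 ha)).
  unfold filtermap, at_right, within in *.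
  apply (filter_imp (fun x => (on_unit x -> P (v x)) /\ (a < x -> a < x < 1))).
  - intros x [h h0] hx. apply h. specialize (h0 hx). unfold on_unit. lra.
  - now apply filter_and.
Qed.

Lemma continuous_on_at_left (v : R -> R) (a : R) :
  continuous_on on_unit v -> 0 < a <= 1 ->
  filterlim v (at_left a) (locally (v a)).
Proof.
  intros hv ha P hP. specialize (hv a ltac:(unfold on_unit; lra) P hP).
  assert (h1 := at_left_interval 0 a (proj1 ha)).
  unfold filtermap, at_left, within in *.
  apply (filter_imp (fun x => (on_unit x -> P (v x)) /\ (x < a -> 0 < x < a))).
  - intros x [h h0] hx. apply h. specialize (h0 hx). unfold on_unit. lra.
  - now apply filter_and.
Qed.

Lemma limit_sqr_unique (Fl : (R -> Prop) -> Prop) {HF : ProperFilter' Fl}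
    (f : R -> R) (m L : R) :
  filterlim f Fl (locally m) -> filterlim (fun r => f r ^ 2) Fl (locally L) ->
  m ^ 2 = L.
Proof.
  intros hf hL.
  apply (filterlim_locally_unique (K := R_AbsRing) (V := R_NormedModule)
    (F := Fl) (fun r => f r ^ 2)); [|exact hL].
  now apply filterlim_sqr; [apply HF|].
Qed.

(** The concrete [F] for the abstract lemmas above, with the constant of the subinterval as
    parameter [c]; [force] is the matching [G]. *)
Definition first_integral (beta gamma c x : R) : R :=
  beta ^ 2 * x ^ 2 + 2 * gamma * exp x + c.

Definition force (beta gamma x : R) : R := beta ^ 2 * x + gamma * exp x.

Lemma is_derive_first_integral (beta gamma c x : R) :
  is_derive (first_integral beta gamma c) x (2 * force beta gamma x).
Proof. unfold first_integral, force. auto_derive; [exact I|ring]. Qed.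

Lemma ex_derive_force (beta gamma x : R) : ex_derive (force beta gamma) x.
Proof. unfold force. auto_derive. exact I. Qed.

(** Stated for a general filter so that right and left limits at the nodes are treated alike. *)
Lemma filterlim_first_integral (Fl : (R -> Prop) -> Prop) {HF : Filter Fl}
    (v dv : R -> R) (beta gamma c y : R) :
  filterlim v Fl (locally y) ->
  Fl (fun r => dv r ^ 2 = first_integral beta gamma c (v r)) ->
  filterlim (fun r => dv r ^ 2) Fl (locally (first_integral beta gamma c y)).
Proof.
  intros hv hE.
  apply (filterlim_ext_loc (fun r => first_integral beta gamma c (v r))).
  - revert hE. apply filter_imp. intros r h. now symmetry.
  - apply (filterlim_comp _ _ _ v (first_integral beta gamma c) _ (locally y)); [exact hv|].
    apply (ex_derive_continuous (V := R_NormedModule) (first_integral beta gamma c)).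
    eexists. apply is_derive_first_integral.
Qed.

Lemma energy_constant (v dv : R -> R) (a b beta gamma : R) :
  (forall r, a < r < b -> is_derive v r (dv r)) ->
  (forall r, a < r < b -> is_derive dv r (force beta gamma (v r))) ->
  exists c, forall r, a < r < b -> dv r ^ 2 = first_integral beta gamma c (v r).
Proof.
  intros hv hdv.
  set (E := fun r => dv r ^ 2 - first_integral beta gamma 0 (v r)).
  assert (hE : forall r, a < r < b -> is_derive E r 0).
  { intros r hr. assert (h1 := hv r hr). assert (h2 := hdv r hr).
    unfold E, first_integral. auto_derive.
    - repeat split; eexists; eassumption.
    - rewrite (is_derive_unique (fun x : R => dv x) _ _ h2), (is_derive_unique (fun x : R => v x) _ _ h1).
      unfold force. ring. }
  (* The midpoint is the reference point because the hypotheses say nothing about the ends of the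
     interval. *)
  exists (E ((a + b) / 2)). intros r hr.
  assert (hEr : E r = E ((a + b) / 2)).
  { destruct (Rtotal_order r ((a + b) / 2)) as [h|[h|h]].
    - apply (eq_is_derive (V := R_NormedModule) E); [|exact h].
      intros x hx. apply hE. lra.
    - congruence.
    - symmetry. apply (eq_is_derive (V := R_NormedModule) E); [|exact h].
      intros x hx. apply hE. lra. }
  rewrite <- hEr. unfold E, first_integral. ring.
Qed.

(** * The sample grid and the first integral at its nodes *)

Lemma sample_grid_increasing (n : nat) (t : nat -> R) (i j : nat) :
  sample_grid n t -> (i <= j)%nat -> (j <= S n)%nat -> t i <= t j.
Proof.
  intros [_ [_ hlt]] hij. induction hij as [|j hij IH]; intros hj; [lra|].
  specialize (IH ltac:(lia)). specialize (hlt j ltac:(lia)). lra.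
Qed.

Lemma sample_grid_interval (n : nat) (t : nat -> R) (i : nat) :
  sample_grid n t -> (i <= n)%nat -> 0 <= t i /\ t i < t (S i) /\ t (S i) <= 1.
Proof.
  intros ht hi.
  assert (h0 := sample_grid_increasing n t 0 i ht ltac:(lia) ltac:(lia)).
  assert (h1 := sample_grid_increasing n t (S i) (S n) ht ltac:(lia) ltac:(lia)).
  destruct ht as [ht0 [ht1 hlt]]. specialize (hlt i hi). lra.
Qed.

(* At [t 0 = 0] right continuity of [dv] is not assumed; there the value of
   [dv ^ 2] is recovered from the one-sided derivative of [v]. *)
Lemma first_integral_at_node (n : nat) (t : nat -> R) (v dv : R -> R)
    (beta gamma c : R) (i : nat) :
  sample_grid n t -> continuous_on on_unit v -> is_dot n t v dv -> (i <= n)%nat ->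
  (forall r, t i < r < t (S i) -> dv r ^ 2 = first_integral beta gamma c (v r)) ->
  dv (t i) ^ 2 = first_integral beta gamma c (v (t i)).
Proof.
  intros ht hv hdv hi hE.
  destruct (sample_grid_interval n t i ht hi) as [h0 [hlt h1]].
  assert (hvi := continuous_on_at_right v (t i) hv ltac:(lra)).
  assert (hL : filterlim (fun r => dv r ^ 2) (at_right (t i))
                 (locally (first_integral beta gamma c (v (t i))))).
  { apply (filterlim_first_integral _ v); [exact hvi|].
    apply (filter_imp (fun r => t i < r < t (S i))); [exact hE|].
    now apply at_right_interval. }
  destruct i as [|i].
  - apply (one_sided_derivative_sqr v dv (t 0%nat) (t 1%nat)); try assumption.
    + intros x hx. now apply (dot_inside n t v dv hdv 0%nat).
    + rewrite (proj1 ht). exact (dot_zero n t v dv hdv).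
  - apply (limit_sqr_unique (at_right (t (S i))) dv); [|exact hL].
    apply (dot_node n t v dv hdv). lia.
Qed.

(** The constant here is that of the subinterval ending at the node. Compared with the value at the
    node, which obeys the next constant, it links the jump to the recursion. *)
Lemma first_integral_left_limit (n : nat) (t : nat -> R) (v dv : R -> R)
    (beta gamma c m : R) (i : nat) :
  sample_grid n t -> continuous_on on_unit v -> (i <= n)%nat ->
  (forall r, t i < r < t (S i) -> dv r ^ 2 = first_integral beta gamma c (v r)) ->
  is_left_limit dv (t (S i)) m ->
  m ^ 2 = first_integral beta gamma c (v (t (S i))).
Proof.
  intros ht hv hi hE hm.
  destruct (sample_grid_interval n t i ht hi) as [h0 [hlt h1]].
  apply (limit_sqr_unique (at_left (t (S i))) dv); [exact hm|].
  apply (filterlim_first_integral _ v).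
  - apply continuous_on_at_left; [exact hv|lra].
  - apply (filter_imp (fun r => t i < r < t (S i))); [exact hE|].
    now apply at_left_interval.
Qed.

(** * The two implications between the second-order and first-order problems *)

Theorem theorem2 (n : nat) (t : nat -> R) (alpha beta : R) (w : R -> R)
  (ht : sample_grid n t) (halpha : 0 < alpha)
  (hw : continuous_on on_unit w)
  (hw0 : forall s : R, on_unit s -> w s = 0)
  (gamma : R) (v dv : R -> R)
  (hv : continuous_on on_unit v)
  (hdv : is_dot n t v dv) :
  (second_order_problem n t alpha beta w gamma v dv ->
   first_order_problem n t alpha beta gamma v dv) /\
  (first_order_problem n t alpha beta gamma v dv ->
   jump_branch n t alpha dv ->
   rests_at_equilibria n t beta gamma v dv ->
   second_order_problem n t alpha beta w gamma v dv).
Proof.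
  assert (hwin : forall i s, (i <= n)%nat -> t i < s < t (S i) -> w s = 0).
  { intros i s hi hs. destruct (sample_grid_interval n t i ht hi) as [h0 [_ h1]].
    apply hw0. unfold on_unit. lra. }
  split.
  - intros [hode h0 h1 hjump].
    (* The energy at the left end of each subinterval. At an interior node [dv (t i)] is the right
       limit, so this energy belongs to the subinterval starting at [t i]. *)
    set (C := fun i => dv (t i) ^ 2 - first_integral beta gamma 0 (v (t i))).
    assert (hE : forall i s, (i <= n)%nat -> t i <= s < t (S i) ->
              dv s ^ 2 = first_integral beta gamma (C i) (v s)).
    { intros i s hi hs.
      destruct (energy_constant v dv (t i) (t (S i)) beta gamma) as [c hc].
      - intros r hr. now apply (dot_inside n t v dv hdv i).
      - intros r hr. assert (h := hode i r hi hr).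
        rewrite (hwin i r hi hr), Rminus_0_r in h. exact h.
      - assert (hn := first_integral_at_node n t v dv beta gamma c i ht hv hdv hi hc).
        assert (hC : C i = c) by (unfold C; rewrite hn; unfold first_integral; ring).
        rewrite hC. destruct (Req_dec s (t i)) as [->|hne]; [exact hn|].
        apply hc. lra. }
    exists C. split.
    + exact hE.
    + exact h1.
    + intros i hi. destruct (hjump i hi) as [m [hm hd]].
      exists m. split; [exact hm|]. destruct i as [|i]; [lia|].
      replace (S i - 1)%nat with i by lia.
      (* By continuity of [v] the terms in [v] agree on both sides of the node, so the two constants
         differ by (m - 1/alpha)^2 - m^2. *)
      assert (hm2 := first_integral_left_limit n t v dv beta gamma (C i) m i ht hv
        ltac:(lia) (fun r hr => hE i r ltac:(lia) ltac:(lra)) hm).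
      replace (C (S i)) with (dv (t (S i)) ^ 2 - first_integral beta gamma 0 (v (t (S i))))
        by reflexivity.
      rewrite hd. unfold first_integral in *.
      replace ((m - 1 / alpha) ^ 2) with (m ^ 2 - 2 / alpha * m + 1 / alpha ^ 2)
        by (field; lra).
      rewrite hm2. ring.
    + unfold C. rewrite (proj1 ht), h0. unfold first_integral. ring.
  - intros [C [hode h1 hstep hinit]] hbranch hrest.
    split.
    + intros i s hi hs. rewrite (hwin i s hi hs), Rminus_0_r.
      apply (first_integral_derive (first_integral beta gamma (C i))
        (force beta gamma) v dv (t i) (t (S i))); try assumption.
      * intros x. apply is_derive_first_integral.
      * intros x. apply ex_derive_force.
      * intros r hr. now apply (dot_inside n t v dv hdv i).
      * intros r hr. apply hode; [exact hi|lra].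
      * intros c d hc hcd hd. now apply (hrest i c d).
    + destruct (sample_grid_interval n t 0 ht ltac:(lia)) as [_ [hlt _]].
      (* At time 0 the initial constant cancels all other terms, leaving [dv 0 ^ 2 = 0]. *)
      assert (h := hode 0%nat (t 0%nat) ltac:(lia) ltac:(lra)).
      rewrite (proj1 ht), hinit in h. nra.
    + exact h1.
    + intros j hj. destruct (hstep j hj) as [m [hm hC]].
      exists m. split; [exact hm|].
      assert (hb := hbranch j m hj hm). destruct j as [|i]; [lia|].
      replace (S i - 1)%nat with i in hC by lia.
      assert (hm2 := first_integral_left_limit n t v dv beta gamma (C i) m i ht hv
        ltac:(lia) (fun r hr => hode i r ltac:(lia) ltac:(lra)) hm).
      destruct (sample_grid_interval n t (S i) ht ltac:(lia)) as [_ [hlt _]].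
      assert (hd := hode (S i) (t (S i)) ltac:(lia) ltac:(lra)).
      (* Read backwards, the recursion yields only the square of the jump condition. *)
      assert (hsq : dv (t (S i)) ^ 2 = (m - 1 / alpha) ^ 2).
      { replace ((m - 1 / alpha) ^ 2) with (m ^ 2 - 2 / alpha * m + 1 / alpha ^ 2)
          by (field; lra).
        rewrite hd, hC, hm2. unfold first_integral. ring. }
      set (p := dv (t (S i))) in *. set (q := m - 1 / alpha) in *.
      (* Equal squares leave p = q or p = -q; [jump_branch] makes p q nonnegative, so the second
         case occurs only when both vanish. *)
      assert (hpq : (p - q) ^ 2 <= 0) by nra.
      nra.
Qed.
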